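(* Let $X\in\mathcal{X}\subseteq\mathbb{R}$ and $Y\in\mathcal{Y}\subseteq\mathbb{R}$ be random variables such that the conditional pdf of $Y$ given $X$ has the univariate exponential family form $$f_{Y|X}(y|x) = h(y)\, e^{x T(y) - \phi(x)}, \qquad y\in\mathcal{Y},\ x\in\mathcal{X},$$ and assume the regularity conditions (R) listed in the context. For integers $\ell\ge1$ let $$\kappa_{X|Y=y}(\ell) = \frac{\mathrm{d}^\ell}{\mathrm{d}t^\ell} \log \mathbb{E}[e^{tX}|Y=y] \Big|_{t=0}$$ be the $\ell$-th conditional cumulant, and let $D_y^{(\ell)}$ be the $\ell$-fold composition of the operator $\frac{1}{T'(y)}\frac{\mathrm{d}}{\mathrm{d}y}$, with $D_y^{(0)}=1$ (the identity). Then, for every integer $\ell\ge1$ and every $y\in\mathcal{Y}$ with $T'(y)\neq0$, $$\kappa_{X|Y=y}(\ell) = D_y^{(\ell-1)}\, \mathbb{E}[X|Y=y].$$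
   Context: Exponential family: $T:\mathcal{Y}\to\mathbb{R}$ is the sufficient statistic, $\phi:\mathcal{X}\to\mathbb{R}$ the log-partition function, $h:\mathcal{Y}\to[0,\infty)$ the base measure. Standing assumptions: $\mathcal{Y}$ is open, $h$ is absolutely continuous with respect to Lebesgue measure, and $T$ is analytic, with $T'$ having only isolated zeros (the operator $D_y^{(\ell)}$ is not defined at those zeros). Regularity conditions (R): for every $t\in\mathbb{R}$: $\mathbb{E}[e^{tX} \mid Y=y]<\infty$, $\mathbb{E}[e^{tX}|X| \mid Y=y]<\infty$ and $\mathbb{E}[|X| \mid Y=y]<\infty$ for all $y\in\mathcal{Y}$; and $y\mapsto e^{tx}\,\iota_{P_{X,Y}}(x;y)$ and $y\mapsto f_{Y|X}(y|x)$ are absolutely continuous for every $x$. Here $\iota_{P_{X,Y}}(x;y) = \log\frac{f_{Y|X}(y|x)}{f_Y(y)}$ is the information density, with $f_Y$ the marginal pdf of $Y$. *)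

(* Defs.v *)
From HB Require Import structures.
From mathcomp Require Import all_boot all_order all_algebra.
From mathcomp Require Import all_classical all_reals all_analysis.

Set Implicit Arguments.
Unset Strict Implicit.
Unset Printing Implicit Defensive.

Import Order.TTheory GRing.Theory Num.Theory.
Import numFieldNormedType.Exports.

Local Open Scope classical_set_scope.
Local Open Scope ring_scope.

(* Functions on a subset of R are represented by total functions R -> R; every
   notion below only constrains their values on the subset. *)

Definition abs_cont_itv (R : realType) (a b : R) (f : R -> R) : Prop :=
  forall e : R, 0 < e -> exists2 d : R, 0 < d &
    forall (n : nat) (u v : 'I_n -> R),
      (forall i, [/\ a <= u i, u i <= v i & v i <= b]) ->
      trivIset [set: 'I_n] (fun i => `]u i, v i[%classic) ->
      \sum_(i < n) (v i - u i) < d ->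
      \sum_(i < n) `|f (v i) - f (u i)| < e.

(* The set Y is open and possibly unbounded, so absolute continuity on Y is
   understood on every compact interval contained in Y: this is weaker than a
   single modulus valid on the whole of Y, which y |-> y ^+ 2 does not have
   on R. *)
Definition abs_cont_on (R : realType) (Y : set R) (f : R -> R) : Prop :=
  forall a b : R, a <= b -> `[a, b]%classic `<=` Y -> abs_cont_itv a b f.

Definition analytic_on (R : realType) (Y : set R) (T : R -> R) : Prop :=
  forall y0 : R, Y y0 -> exists c : nat -> R,
    \forall y \near y0, pseries c (y - y0) @ \oo --> T y.

Definition isolated_zeros_on (R : realType) (Y : set R) (g : R -> R) : Prop :=
  forall y0 : R, Y y0 -> g y0 = 0 -> \forall y \near y0^', g y != 0.

(* [h] is the density with respect to Lebesgue measure of the base measure,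
   which is thereby absolutely continuous; [phi] is the logarithm of the
   normalizing integral. *)
Record exponential_family (R : realType) (XX YY : set R) (T phi h : R -> R)
    : Prop := ExponentialFamily {
  ef_open : open YY ;
  ef_h_ge0 : forall y, YY y -> 0 <= h y ;
  ef_h_meas : measurable_fun YY h ;
  ef_T_analytic : analytic_on YY T ;
  ef_T_zeros : isolated_zeros_on YY (derive1 T) ;
  ef_log_partition : forall x, XX x ->
    (phi x)%:E
      = lne (\int[@lebesgue_measure R]_(y in YY) (h y * expR (x * T y))%:E)%E
}.

Section conditioning.
Context (R : realType) (d : measure_display) (Omega : measurableType d).
Context (P : probability Omega R).

(* f x y stands for f_{Y|X}(y|x).  The double integral is taken over Omega
   rather than over the law of X so that f x is only used for x in XX, which
   need not be measurable. *)
Record is_conditional_pdf (X Y : {RV P >-> R}) (XX YY : set R)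
    (f : R -> R -> R) : Prop := IsConditionalPdf {
  cpdf_ge0 : forall x y, XX x -> YY y -> 0 <= f x y ;
  cpdf_meas : forall x, XX x -> measurable_fun YY (f x) ;
  cpdf_total : forall x, XX x ->
    (\int[@lebesgue_measure R]_(y in YY) (f x y)%:E = 1)%E ;
  cpdf_joint : forall A B : set R, measurable A -> measurable B ->
    (P (X @^-1` A `&` Y @^-1` B)
      = \int[P]_(w in X @^-1` A)
          \int[@lebesgue_measure R]_(y in B `&` YY) (f (X w) y)%:E)%E
}.

Definition marginal_pdf (X : {RV P >-> R}) (f : R -> R -> R) (y : R) : \bar R :=
  'E_P[fun w => f (X w) y].

(* Extended-real valued: equal to -oo when f x y = 0, in particular at the
   points where the ratio is 0 / 0. *)
Definition information_density (X : {RV P >-> R}) (f : R -> R -> R) (x y : R)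
    : \bar R :=
  lne ((f x y)%:E / marginal_pdf X f y)%E.

(* E[g(X) | Y = y].  Conditional expectations are determined by the joint law
   only for almost every y; pointwise statements refer to the version given by
   Bayes' rule, in which X given Y = y has density
   f_{Y|X}(y|x) / f_Y(y) = exp(information density) with respect to the law
   of X. *)
Definition cond_expectation (X : {RV P >-> R}) (f : R -> R -> R) (g : R -> R)
    (y : R) : \bar R :=
  ('E_P[fun w => (g (X w) * f (X w) y)%R] / marginal_pdf X f y)%E.

Definition cond_mean (X : {RV P >-> R}) (f : R -> R -> R) (y : R) : R :=
  fine (cond_expectation X f id y).

Definition cond_cgf (X : {RV P >-> R}) (f : R -> R -> R) (y t : R) : R :=
  ln (fine (cond_expectation X f (fun x => expR (t * x)) y)).

Definition cond_cumulant (X : {RV P >-> R}) (f : R -> R -> R) (l : nat) (y : R)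
    : R :=
  derive1n l (cond_cgf X f y) 0.

(* [reg_info_fin] is the requirement that the information density be a
   real-valued function on XX x YY, as is implicit in calling
   y |-> e^{tx} iota(x; y) absolutely continuous; [fine] loses nothing then. *)
Record regularity (X : {RV P >-> R}) (XX YY : set R) (f : R -> R -> R)
    : Prop := Regularity {
  reg_mgf : forall t y, YY y ->
    (cond_expectation X f (fun x => expR (t * x)%R) y < +oo)%E ;
  reg_mgf_abs : forall t y, YY y ->
    (cond_expectation X f (fun x => (expR (t * x) * `|x|)%R) y < +oo)%E ;
  reg_abs : forall y, YY y ->
    (cond_expectation X f (fun x => `|x|%R) y < +oo)%E ;
  reg_info_fin : forall x y, XX x -> YY y ->
    information_density X f x y \is a fin_num ;
  reg_info_ac : forall t x, XX x ->
    abs_cont_on YY (fun y => expR (t * x) * fine (information_density X f x y)) ;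
  reg_pdf_ac : forall x, XX x -> abs_cont_on YY (f x)
}.

End conditioning.

Definition D_op (R : realType) (T : R -> R) (g : R -> R) : R -> R :=
  fun y => (derive1 T y)^-1 * derive1 g y.

Definition D_iter (R : realType) (T : R -> R) (l : nat) (g : R -> R) : R -> R :=
  iter l (D_op T) g.

(* [derive1] is total, so that the derivatives involved exist is stated
   separately from formulas about them. *)
Definition diff_times_near (R : realType) (l : nat) (g : R -> R) (a : R) : Prop :=
  forall k, (k < l)%N -> \forall t \near a, derivable (derive1n k g) t 1.

Definition D_iter_defined (R : realType) (T : R -> R) (l : nat) (g : R -> R)
    (a : R) : Prop :=
  forall k, (k < l)%N -> \forall y \near a, derivable (D_iter T k g) y 1.

(* Main.v *)
(* Put M k s = E[X^k exp(s X - phi(X))].  By Bayes' rule the factor h(y)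
   cancels, so E[e^{tX} | Y = y] = M 0 (t + T y) / M 0 (T y) and
   E[X | Y = y] = L (T y) with L = M 1 / M 0 = (ln M 0)'.  The moment condition
   makes every M k s finite, and differentiating under the integral gives
   (M k)' = M (k + 1), so L is smooth.  The l-th cumulant is then the (l - 1)-th
   derivative of L at T y, and the chain rule turns (1 / T') d/dy on functions
   G (T y) into G' (T y). *)
Require Import Defs.
From HB Require Import structures.
From mathcomp Require Import all_boot all_order all_algebra.
From mathcomp Require Import all_classical all_reals all_analysis.
From mathcomp Require Import measurable_realfun ring lra.

Set Implicit Arguments.
Unset Strict Implicit.
Unset Printing Implicit Defensive.

Import Order.TTheory GRing.Theory Num.Theory.
Import numFieldNormedType.Exports.

Local Open Scope classical_set_scope.
Local Open Scope ring_scope.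

(** * Power series: termwise differentiation, and continuity of the derivative of an analytic
    function *)

Lemma sum_succ_geometricE (R : realType) (r : R) (n : nat) :
  (\sum_(0 <= i < n) i.+1%:R * r ^+ i) * (1 - r) ^+ 2
  = 1 - n.+1%:R * r ^+ n + n%:R * r ^+ n.+1.
Proof.
elim: n => [|n IH].
  by rewrite big_nil mul0r expr0 mulr1 mul0r addr0 subrr.
rewrite big_nat_recr//= mulrDl IH -(natr1 n.+1) -(natr1 n) !exprS; ring.
Qed.

(** The partial sums increase and, by the closed form above, stay below [1 / (1 - r) ^+ 2]. *)
Lemma is_cvg_series_succ_geometric (R : realType) (r : R) :
  0 <= r < 1 -> cvgn [series i.+1%:R * r ^+ i]_i.
Proof.
move=> /andP[r0 r1].
apply: nondecreasing_is_cvgn.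
  apply/nondecreasing_seqP => n.
  by rewrite /series/= big_nat_recr//= lerDl mulr_ge0// exprn_ge0.
exists (((1 - r) ^+ 2)^-1) => _ [n _ <-].
have q0 : 0 < (1 - r) ^+ 2 by rewrite exprn_gt0// subr_gt0.
rewrite -[leRHS]mul1r ler_pdivlMr// /series/= sum_succ_geometricE.
rewrite -addrA gerDl addrC subr_le0 ler_pM//.
- by rewrite exprn_ge0.
- by rewrite ler_nat.
- by rewrite exprS ler_piMl ?exprn_ge0// ltW.
Qed.

(** Convergence at [x] bounds [|c n| * |x| ^+ n]. The differentiated terms at [z] are then at most a
    constant times [(n + 1) * r ^+ n] with [r = |z| / |x| < 1]. *)
Lemma is_cvg_pseries_diffs (R : realType) (c : nat -> R) (x z : R) :
  cvgn (pseries c x) -> `|z| < `|x| -> cvgn (pseries (pseries_diffs c) z).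
Proof.
move=> Cx zx; have [M [_ Mc]] := cvg_series_bounded Cx.
have x0 : 0 < `|x| by exact: le_lt_trans zx.
have {}Mc n : `|c n| * `|x| ^+ n <= M + 1.
  by rewrite -normrX -normrM; apply: Mc => //; rewrite ltrDl.
set r := `|z| / `|x|.
have r01 : 0 <= r < 1 by rewrite divr_ge0//= ltr_pdivrMr// mul1r.
apply: normed_cvg.
pose v := (M + 1) / `|x| *: (fun i : nat => i.+1%:R * r ^+ i).
apply: (@series_le_cvg _ _ v) => [n|n|n|] //=.
- rewrite /v/= !mulr_ge0// ?invr_ge0// ?exprn_ge0//; last by case/andP: r01.
  by apply: le_trans (Mc 0%N); rewrite mulr_ge0// exprn_ge0.
- rewrite /v /pseries_diffs/= !normrM normrX normr_nat.
  rewrite /GRing.scale/= [leRHS]mulrCA -mulrA ler_wpM2l//.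
  rewrite /r expr_div_n mulrA ler_pdivlMr ?exprn_gt0// mulrAC.
  rewrite ler_wpM2r ?exprn_ge0// ler_pdivlMr//.
  by rewrite -mulrA -exprSr.
- exact/is_cvg_seriesZ/is_cvg_series_succ_geometric.
Qed.

Lemma is_cvg_pseries_diffs_ball (R : realType) (c : nat -> R) (r : R) :
  (forall x, `|x| < r -> cvgn (pseries c x)) ->
  forall x, `|x| < r -> cvgn (pseries (pseries_diffs c) x).
Proof.
move=> cvg_c x xr.
have rx : 0 <= (`|x| + r) / 2.
  by rewrite divr_ge0// addr_ge0// (le_trans _ (ltW xr)).
apply: (@is_cvg_pseries_diffs _ _ ((`|x| + r) / 2)).
  by apply: cvg_c; rewrite ger0_norm// midf_lt.
by rewrite (ger0_norm rx) midf_lt.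
Qed.

Lemma is_derive_pseries (R : realType) (c : nat -> R) (r z : R) :
  (forall x, `|x| < r -> cvgn (pseries c x)) -> `|z| < r ->
  is_derive z (1 : R) (fun x => limn (pseries c x))
    (limn (pseries (pseries_diffs c) z)).
Proof.
move=> cvg_c zr.
(* [K] lies strictly between [|z|] and [r]: termwise differentiation at [z] asks for convergence at
   such a point of the series and of its first two formal derivatives. *)
pose K := (`|z| + r) / 2.
have K0 : 0 <= K.
  by rewrite divr_ge0// addr_ge0// (le_trans _ (ltW zr)).
have Kr : `|K| < r by rewrite ger0_norm// midf_lt.
apply: (@pseries_snd_diffs _ _ K).
- exact: cvg_c.
- exact: (is_cvg_pseries_diffs_ball cvg_c).
- by do 2 apply: (@is_cvg_pseries_diffs_ball _ _ r) => //.
- by rewrite (ger0_norm K0) midf_lt.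
Qed.

(** Near [y0], [T] is the sum of a power series and its derivative the sum of the formal derivative.
    That sum is itself differentiable at the centre, hence continuous there. *)
Lemma analytic_on_C1 (R : realType) (Y : set R) (T : R -> R) (y0 : R) :
  analytic_on Y T -> Y y0 ->
  (\forall y \near y0, derivable T y 1) /\ {for y0, continuous (derive1 T)}.
Proof.
move=> aT Yy0; have [c /nbhs_ballP[r /= r0 cT]] := aT _ Yy0.
have cvg_c x : `|x| < r -> cvgn (pseries c x).
  move=> xr; have /= := cT (x + y0); rewrite /ball/= addrK opprD addrCA subrr.
  by rewrite addr0 normrN => /(_ xr) h; apply/cvg_ex; eexists; exact: h.
have cvg_c' := is_cvg_pseries_diffs_ball cvg_c.
have dT y : `|y - y0| < r ->
    is_derive y (1 : R) T (limn (pseries (pseries_diffs c) (y - y0))).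
  move=> yr.
  have nT : \forall t \near y, limn (pseries c (t - y0)) = T t.
    have : \forall t \near y, `|t - y0| < r.
      have yc : (fun t => t - y0) t @[t --> y] --> y - y0.
        by apply: cvgB => //; exact: cvg_cst.
      exact: (cvgr_norm_lt _ yc).
    apply: filterS => t tr; apply/cvg_lim => //; apply: cT.
    by rewrite /ball/= distrC.
  apply: (near_eq_is_derive nT).
  have := is_derive_pseries cvg_c yr => h.
  rewrite (_ : (fun t => limn (pseries c (t - y0)))
    = (fun x => limn (pseries c x)) \o (fun t => t - y0))//.
  rewrite -[X in is_derive _ _ _ X]mulr1.
  apply: is_derive1_comp.
  exact: is_derive_shift.
have near_r : \forall y \near y0, `|y - y0| < r.
  by apply/nbhs_ballP; exists r => //= y; rewrite /ball/= distrC.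
split; first by apply: filterS near_r => y /dT[].
have eT : \forall y \near y0,
    limn (pseries (pseries_diffs c) (y - y0)) = derive1 T y.
  by apply: filterS near_r => y /dT[_ dTy]; rewrite derive1E dTy.
have dS := is_derive_pseries cvg_c' (_ : `|0| < r).
have {}dS : {for 0, continuous (fun x => limn (pseries (pseries_diffs c) x))}.
  apply/differentiable_continuous/derivable1_diffP; apply: ex_derive.
  by apply: dS; rewrite normr0.
suff h : limn (pseries (pseries_diffs c) (y - y0)) @[y --> y0]
    --> limn (pseries (pseries_diffs c) (y0 - y0)).
  rewrite /prop_for /continuous_at -(nbhs_singleton eT).
  by apply: cvg_trans h; exact: near_eq_cvg.
apply: (@continuous_comp _ _ _ (fun y => y - y0)
  (fun x => limn (pseries (pseries_diffs c) x))).
  by apply: cvgB; [exact: cvg_id|exact: cvg_cst].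
by rewrite subrr.
Qed.

(** * Exponential bounds, and differentiation of tilted moments under the integral *)

Lemma expR_le_endpoints (R : realType) (b s c x : R) :
  b <= s <= c -> expR (s * x) <= expR (b * x) + expR (c * x).
Proof.
move=> /andP[bs sc]; have [x0|x0] := leP 0 x.
  by rewrite ler_wpDl ?expR_ge0// ler_expR ler_wpM2r.
by rewrite ler_wpDr ?expR_ge0// ler_expR ler_wnM2r// ltW.
Qed.

(** For positive [k], [|x| ^+ k / k!] is a single term of the exponential series at [|x|]. *)
Lemma norm_exprn_le_expR (R : realType) (k : nat) (x : R) :
  `|x| ^+ k <= k`!%:R * expR `|x|.
Proof.
case: k => [|k]; first by rewrite expr0 fact0 mul1r -expR0 ler_expR.
rewrite -ler_pdivrMl ?ltr0n ?fact_gt0// mulrC.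
by apply: le_trans (expR_ge1Dxn k (normr_ge0 x)); rewrite lerDr.
Qed.

(** The power is absorbed by [expR |x|], which moves the tilt [s] by one unit in the direction of
    the sign of [x]; the margin of 1 keeps it within [[b, c]]. *)
Lemma norm_exprn_expR_le (R : realType) (k : nat) (b s c x : R) :
  b + 1 <= s <= c - 1 ->
  `|x| ^+ k * expR (s * x) <= k`!%:R * (expR (b * x) + expR (c * x)) *+ 2.
Proof.
move=> /andP[bs sc].
have sx (e : R) : `|e| <= 1 ->
    expR ((s + e) * x) <= expR (b * x) + expR (c * x).
  by rewrite ler_norml => /andP[? ?]; apply: expR_le_endpoints; apply/andP; lra.
apply: (@le_trans _ _ (k`!%:R * (expR `|x| * expR (s * x)))).
  by rewrite mulrA ler_wpM2r ?expR_ge0// norm_exprn_le_expR.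
rewrite -mulrnAr ler_wpM2l// -expRD.
apply: (@le_trans _ _ (expR (b * x) + expR (c * x))); last first.
  by rewrite mulr2n lerDl addr_ge0// expR_ge0.
have [x0|x0] := leP 0 x.
  by have -> : `|x| + s * x = (s + 1) * x;
    [rewrite ger0_norm//; ring|rewrite sx// normr1].
by have -> : `|x| + s * x = (s - 1) * x;
  [rewrite ltr0_norm//; ring|rewrite sx// normrN normr1].
Qed.

(** With [p = exp(- phi(X))] and [mu = P] this is the [M k s] of the sketch above. *)
Definition tilted_moment d (Omega : measurableType d) (R : realType)
    (mu : {measure set Omega -> \bar R}) (X p : Omega -> R) (k : nat) (s : R)
    : R :=
  \int[mu]_w (X w ^+ k * (p w * expR (s * X w))).

Section tilted_moments.
Context d (Omega : measurableType d) (R : realType).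
Context (mu : {measure set Omega -> \bar R}) (X p : Omega -> R).
Hypothesis mX : measurable_fun setT X.
Hypothesis p_ge0 : forall w, 0 <= p w.
Hypothesis int_exp : forall s,
  mu.-integrable setT (EFin \o (fun w => p w * expR (s * X w))).

(** Majorant of the integrand of order [k], common to all tilts in [[b + 1, c - 1]], as dominated
    differentiation requires. *)
Let dom k b c w : R :=
  k`!%:R *+ 2 * (p w * expR (b * X w) + p w * expR (c * X w)).

Let int_dom k b c : mu.-integrable setT (EFin \o dom k b c).
Proof.
have := integrableZl measurableT (k`!%:R *+ 2)
  (integrableD measurableT (int_exp b) (int_exp c)).
by apply: eq_integrable.
Qed.

Let mom_le_dom k b s c w : b + 1 <= s <= c - 1 ->
  `|X w ^+ k * (p w * expR (s * X w))| <= dom k b c w.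
Proof.
move=> bsc; rewrite !normrM normrX (ger0_norm (p_ge0 w))
  (ger0_norm (expR_ge0 _)).
rewrite mulrCA /dom -mulrDr [leRHS]mulrCA ler_wpM2l// mulrnAl.
exact: norm_exprn_expR_le.
Qed.

Let mp : measurable_fun setT p.
Proof.
have /integrableP[/measurable_EFinP + _] := int_exp 0.
by apply: eq_measurable_fun => w _; rewrite mul0r expR0 mulr1.
Qed.

Lemma integrable_tilted k s :
  mu.-integrable setT (EFin \o (fun w => X w ^+ k * (p w * expR (s * X w)))).
Proof.
(* The bounds [s - 1] and [s + 1] leave exactly the tilt [s] in the dominated range. *)
apply: (le_integrable measurableT _ _ (int_dom k (s - 1) (s + 1))).
  apply/measurable_EFinP; apply: measurable_funM.
    exact: measurable_funX.
  apply: measurable_funM => //; apply: measurableT_comp => //.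
  exact: measurable_funM.
move=> w _; rewrite lee_fin [leRHS]ger0_norm; last first.
  by rewrite /dom !(mulr_ge0, addr_ge0)// ?mulrn_wge0// expR_ge0.
by apply: mom_le_dom; rewrite subrK addrK lexx.
Qed.

Lemma is_derive_tilted_moment k s :
  is_derive s (1 : R) (tilted_moment mu X p k) (tilted_moment mu X p k.+1 s).
Proof.
pose f (s : R) w := X w ^+ k * (p w * expR (s * X w)).
have df t w : is_derive t (1 : R) (f ^~ w)
    (X w ^+ k.+1 * (p w * expR (t * X w))).
  have dX : is_derive t (1 : R) (fun t => t * X w) (X w).
    have -> : (fun t => t * X w) = X w \*: (@id R).
      by apply/funext => u; rewrite /= mulrC.
    by apply: is_derive_eq; rewrite [LHS]mulr1.
  have dexp := @is_derive1_comp _ expR _ _ _ _ (is_derive_expR _) dX.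
  have -> : f ^~ w = (X w ^+ k * p w) *: (expR \o (fun t => t * X w)).
    by apply/funext => u; rewrite /f mulrA.
  by apply: is_derive_eq; rewrite /= exprS /GRing.scale/=; ring.
have f1 t w : partial1of2 f t w = X w ^+ k.+1 * (p w * expR (t * X w)).
  by rewrite partial1of2E; have [_ ->] := df t w.
have sI : [set` `]s - 1, s + 1[] s.
  by rewrite /= in_itv/=; apply/andP; lra.
have intf t : [set` `]s - 1, s + 1[] t -> mu.-integrable setT (EFin \o f t).
  by move=> _; exact: integrable_tilted.
have derf t w : [set` `]s - 1, s + 1[] t -> setT w -> derivable (f ^~ w) t 1.
  by move=> _ _; have [] := df t w.
have dom_ge0 w : 0 <= dom k.+1 (s - 2) (s + 2) w.
  by rewrite /dom !(mulr_ge0, addr_ge0)// ?mulrn_wge0// expR_ge0.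
(* A tilt in []s - 1, s + 1[] is at least one unit away from [s - 2] and [s + 2], so one majorant
   serves the whole interval. *)
have ub t w : [set` `]s - 1, s + 1[] t -> setT w ->
    `|partial1of2 f t w| <= dom k.+1 (s - 2) (s + 2) w.
  rewrite f1 /= in_itv/= => /andP[? ?] _; apply: mom_le_dom; apply/andP; lra.
apply: DeriveDef.
  exact: (derivable_under_integral measurableT sI intf derf dom_ge0
    (int_dom _ _ _) ub).
rewrite -derive1E.
rewrite (differentiation_under_integral measurableT sI intf derf dom_ge0
  (int_dom _ _ _) ub).
by apply: eq_Rintegral => w _; exact: f1.
Qed.

(** If the integral of this nonnegative function were 0, it would vanish almost everywhere; being
    positive everywhere, it would force the whole space to be negligible. *)
Lemma tilted_moment0_gt0 s : mu setT != 0%E -> (forall w, 0 < p w) ->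
  0 < tilted_moment mu X p 0 s.
Proof.
move=> mu0 p0.
have m0 : 0 <= tilted_moment mu X p 0 s.
  by apply: Rintegral_ge0 => w _; rewrite expr0 mul1r mulr_ge0 ?expR_ge0.
rewrite lt_neqAle m0 andbT eq_sym; apply: contra mu0 => /eqP m0E.
have mi := integrable_tilted 0 s.
have /(ae_eq_integral_abs _ measurableT) :
    (\int[mu]_w `|(X w ^+ 0 * (p w * expR (s * X w)))%:E| = 0)%E.
  rewrite -[RHS]/(0%:E) -m0E /tilted_moment /Rintegral fineK//; last first.
    exact: integrable_fin_num.
  apply: eq_integral => w _; rewrite gee0_abs// lee_fin expr0 mul1r.
  by rewrite mulr_ge0 ?expR_ge0.
case/integrableP : (mi) => mf _ /(_ mf) [N [mN N0 subN]].
rewrite -measure_le0 -N0 le_measure ?inE//.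
apply: subset_trans subN => w _ /= /(_ I) [] /eqP.
by rewrite expr0 mul1r gt_eqF// mulr_gt0// expR_gt0.
Qed.

End tilted_moments.

(** * Smoothness of the logarithmic derivative of [M 0] *)

(* Closed under differentiation, because (1 / M 0)' = - M 1 / M 0 ^+ 2; it
   contains M 1 / M 0, which is therefore smooth. *)
Inductive moment_algebra (R : realType) (M : nat -> R -> R)
    : (R -> R) -> Prop :=
| MAmoment n : moment_algebra M (M n)
| MAinv : moment_algebra M (fun x => (M 0 x)^-1)
| MAopp f : moment_algebra M f -> moment_algebra M (- f)
| MAadd f g : moment_algebra M f -> moment_algebra M g ->
    moment_algebra M (f + g)
| MAmul f g : moment_algebra M f -> moment_algebra M g ->
    moment_algebra M (f * g).

Section log_derivative.
Context (R : realType) (M : nat -> R -> R).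
Hypothesis dM : forall n x, is_derive x (1 : R) (M n) (M n.+1 x).
Hypothesis M0 : forall x, 0 < M 0 x.

(** The derivative is produced together with its membership in the algebra, which lets the statement
    be iterated to every order. *)
Lemma moment_algebra_derive (f : R -> R) : moment_algebra M f ->
  exists2 f', moment_algebra M f' & forall x, is_derive x (1 : R) f (f' x).
Proof.
elim=> {f} [n||f _ [f' Df' df]|f g _ [f' Df' df] _ [g' Dg' dg]
           |f g Df [f' Df' df] Dg [g' Dg' dg]].
- by exists (M n.+1) => //; exact: MAmoment.
- exists (- ((fun x => (M 0 x)^-1) * (fun x => (M 0 x)^-1) * M 1)).
    by apply/MAopp/MAmul; [apply: MAmul|]; constructor.
  move=> x; have M0x : M 0 x != 0 by rewrite gt_eqF.
  have := is_deriveV M0x (dM 0 x); rewrite !fctE.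
  by rewrite /GRing.scale/= -invfM -expr2 mulNr.
- by exists (- f'); [exact: MAopp|move=> x; exact: is_deriveN].
- by exists (f' + g'); [exact: MAadd|move=> x; exact: is_deriveD].
- exists (f * g' + g * f'); first by apply: MAadd; exact: MAmul.
  by move=> x; exact: is_deriveM.
Qed.

Lemma moment_algebra_derive1n (f : R -> R) n :
  moment_algebra M f -> moment_algebra M (derive1n n f).
Proof.
move=> Df; elim: n => // n /moment_algebra_derive[f' Df' df].
rewrite derive1nS (_ : derive1 _ = f')//.
by apply/funext => x; rewrite derive1E; have [_ ->] := df x.
Qed.

(** The [L] of the sketch, written as a product of two generators of [moment_algebra]. *)
Definition log_derivative : R -> R := M 1 * (fun x => (M 0 x)^-1).

Lemma derivable_log_derivativen n x :
  derivable (derive1n n log_derivative) x 1.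
Proof.
have Dlog : moment_algebra M log_derivative := MAmul (MAmoment M 1) (MAinv M).
have [f' _ df] := moment_algebra_derive (moment_algebra_derive1n n Dlog).
by have [] := df x.
Qed.

Lemma is_derive_ln_moment x :
  is_derive x (1 : R) (fun t => ln (M 0 t)) (log_derivative x).
Proof.
have := @is_derive1_comp _ (@ln R) (M 0) x _ _ (is_derive1_ln (M0 x)) (dM 0 x).
by rewrite mulrC.
Qed.

End log_derivative.

(** * Iterated derivatives under a shift and under composition with [T] *)

Lemma derive1n_shift (R : realType) (f : R -> R) (a : R) n :
  (forall k x, derivable (derive1n k f) x 1) ->
  derive1n n (fun x => f (x + a)) = (fun x => derive1n n f (x + a)).
Proof.
move=> df; elim: n => // n IH; rewrite derive1nS IH; apply/funext => x.
have [da Da] := is_derive_shift x (1 : R) a.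
by rewrite (@derive1_comp _ (shift a) (derive1n n f))//
  [X in _ * X]derive1E Da mulr1.
Qed.

(** Differentiating at a point [z] near [y] needs an identity on a neighbourhood of [z], not only at
    [z]. *)
Lemma near_near (R : realType) (y : R) (Q : R -> Prop) :
  (\forall z \near y, Q z) -> \forall z \near y, \forall t \near z, Q t.
Proof. by move=> /nbhs_interior. Qed.

(** Each application of the operator produces a factor [T'] by the chain rule, cancelled by its
    inverse. The identity is carried on a neighbourhood of [y] because the next derivative depends
    on nearby values. *)
Lemma D_iter_comp (R : realType) (T g G : R -> R) (y : R) n :
  (forall k x, derivable (derive1n k G) x 1) ->
  (\forall z \near y, g z = G (T z)) ->
  (\forall z \near y, derivable T z 1 /\ derive1 T z != 0) ->
  \forall z \near y, D_iter T n g z = derive1n n G (T z).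
Proof.
move=> dG gG dT; elim: n => [|n IH]; first exact: gG.
have IH' := near_near IH; near=> z.
have [dTz T'z] : derivable T z 1 /\ derive1 T z != 0 by near: z.
have e : \forall t \near z, D_iter T n g t = (derive1n n G \o T) t.
  by near: z.
rewrite (_ : D_iter T n.+1 g z = (derive1 T z)^-1 * derive1 (D_iter T n g) z)//.
rewrite [X in _ * X]derive1E (near_eq_derive _ e) -derive1E
  (@derive1_comp _ T (derive1n n G))//.
by rewrite mulrCA mulVf ?mulr1.
Unshelve. all: by end_near. Qed.

Lemma D_iter_comp_defined (R : realType) (T g G : R -> R) (y : R) n :
  (forall k x, derivable (derive1n k G) x 1) ->
  (\forall z \near y, g z = G (T z)) ->
  (\forall z \near y, derivable T z 1 /\ derive1 T z != 0) ->
  D_iter_defined T n g y.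
Proof.
move=> dG gG dT k _; have e := near_near (D_iter_comp k dG gG dT).
near=> z.
have [dTz T'z] : derivable T z 1 /\ derive1 T z != 0 by near: z.
apply: (@near_eq_derivable _ _ _ (derive1n k G \o T)).
  near: z; apply: filterS e => z; apply: filterS => t ->//.
by apply/derivable1_diffP/differentiable_comp; apply/derivable1_diffP.
Unshelve. all: by end_near. Qed.

(** * Measurability of the log-partition function along [X] *)

Lemma lne_fin_num_gt0 (R : realType) (x : \bar R) :
  lne x \is a fin_num -> exists2 r, 0 < r & x = r%:E.
Proof.
case: x => [r| |]//=; have [//|r0 _] := leP r 0.
by exists r.
Qed.

(* XX need not be measurable and phi is unspecified outside it, but along X it
   is the logarithm of an integral that depends measurably on x by Tonelli. *)
Lemma measurable_log_partition (R : realType) (d : measure_display)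
    (Omega : measurableType d) (X : Omega -> R) (XX YY : set R)
    (T phi h : R -> R) :
  exponential_family XX YY T phi h -> (forall w, XX (X w)) ->
  measurable_fun setT X -> measurable_fun setT (phi \o X).
Proof.
case=> oYY h0 mh aT _ phiE XXX mX.
have mYY : measurable YY by exact: open_measurable.
have mT : measurable_fun YY T.
  apply: open_continuous_measurable_fun => // y /set_mem YYy.
  have [/nbhs_singleton dT _] := analytic_on_C1 aT YYy.
  exact/differentiable_continuous/derivable1_diffP.
(* Extending [h] and [T] by 0 outside [YY] makes the integrand jointly measurable on the plane
   without changing the integral over [YY]. *)
pose F (z : R * R) : \bar R :=
  ((h \_ YY) z.2 * expR (z.1 * (T \_ YY) z.2))%:E.
have hYY0 y : 0 <= (h \_ YY) y.
  by rewrite patchE; case: ifPn => // /set_mem; exact: h0.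
have mF : measurable_fun setT F.
  apply/measurable_EFinP; apply: measurable_funM.
    apply: measurableT_comp => //; exact/(measurable_restrictT _ mYY).
  apply: measurableT_comp => //; apply: measurable_funM => //.
  apply: measurableT_comp => //; exact/(measurable_restrictT _ mYY).
have F0 z : (0 <= F z)%E by rewrite lee_fin mulr_ge0 ?expR_ge0.
have mI := measurable_fun_fubini_tonelli_F (m2 := @lebesgue_measure R) F mF F0.
(* As [phi] is real-valued, [lne] of the integral is finite; the integral is thus a positive real
   and [fine] keeps its value. *)
have phiXE w : phi (X w) = ln (fine (fubini_F (@lebesgue_measure R) F (X w))).
  have IE : (\int[@lebesgue_measure R]_(y in YY) (h y * expR (X w * T y))%:E
      = fubini_F (@lebesgue_measure R) F (X w))%E.
    rewrite integral_mkcond; apply: eq_integral => y _.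
    by rewrite /F !patchE/=; case: ifPn => // _; rewrite mul0r.
  have := phiE _ (XXX w); rewrite IE => pE.
  have [|r r0 rE] :=
    @lne_fin_num_gt0 _ (fubini_F (@lebesgue_measure R) F (X w)).
    by rewrite -pE.
  by move: pE; rewrite rE lne_EFin// => -[].
have -> : phi \o X = @ln R \o (fine \o (fubini_F (@lebesgue_measure R) F \o X)).
  by apply/funext => w; exact: phiXE.
apply: measurableT_comp => //; apply: measurableT_comp => //.
exact: measurableT_comp.
Qed.

(** * Conditional moments and cumulants through Bayes' rule *)

Section conditional_moments.
Context (R : realType) (d : measure_display) (Omega : measurableType d).
Context (P : probability Omega R) (X : {RV P >-> R}) (XX YY : set R).
Context (T phi h : R -> R) (f : R -> R -> R).
Hypothesis XXX : forall w, XX (X w).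
Hypothesis fam : exponential_family XX YY T phi h.
Hypothesis fE : forall x y, XX x -> YY y ->
  f x y = h y * expR (x * T y - phi x).
Hypothesis reg : regularity X XX YY f.

(** The factor of the density along [X] that is free of [y]; what remains is [h y] and a tilt by
    [T y]. *)
Let p w := expR (- phi (X w)).

Let p_gt0 w : 0 < p w. Proof. exact: expR_gt0. Qed.

Let fpE w y : YY y -> f (X w) y = h y * (p w * expR (T y * X w)).
Proof.
by move=> YYy; rewrite fE// /p -expRD [in RHS]addrC [in RHS](mulrC (T y)).
Qed.

(** Provides a value [X w] in [XX] at which the finiteness of the information density can be
    used. *)
Let Omega_neq0 : exists w : Omega, True.
Proof.
apply/not_existsP => noW; have : P setT = 0%E.
  rewrite (_ : setT = set0) ?measure0//.
  by apply/seteqP; split=> // w _; exact: (noW w).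
by rewrite probability_setT => /eqP; rewrite onee_eq0.
Qed.

(* A vanishing h y, or a marginal equal to 0 or +oo, would make the information
   density infinite. *)
Let marginal_pdf_gt0 y : YY y ->
  0 < h y /\ exists2 m, 0 < m & marginal_pdf X f y = m%:E.
Proof.
move=> YYy; have [w _] := Omega_neq0.
have [q q0] := lne_fin_num_gt0 (reg_info_fin reg (XXX w) YYy).
have h0 : 0 <= h y by exact: (ef_h_ge0 fam).
have m0 : (0 <= marginal_pdf X f y)%E.
  by apply: expectation_ge0 => w'; rewrite fpE// !mulr_ge0// expR_ge0.
case: (marginal_pdf X f y) m0 => [m| |]//; last first.
  by rewrite invey mule0 => _ [] /esym/eqP; rewrite gt_eqF.
(* The inverse of 0 is [+oo] in [\bar R], so a zero marginal makes the ratio 0 or infinite, never a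
   positive real. *)
rewrite lee_fin le_eqVlt => /predU1P[<-|m0].
  rewrite inve0; have [->|fn0] := eqVneq (f (X w) y) 0.
    by rewrite mul0e => -[] /esym/eqP; rewrite gt_eqF.
  rewrite mulry; case: (sgrP (f (X w) y)) fn0 => //; rewrite ?mul1e//.
  by rewrite EFinN mulN1e.
rewrite inver gt_eqF// => -[qE]; split; last by exists m.
rewrite lt_neqAle h0 andbT; apply: contraPneq qE => hy0; apply/eqP.
by rewrite fpE// -hy0 !mul0r lt_eqF.
Qed.

Let mX : measurable_fun setT X.
Proof. exact: measurable_funPT. Qed.

Let mp : measurable_fun setT p.
Proof.
apply: measurableT_comp => //; apply: measurableT_comp => //.
exact: (measurable_log_partition fam).
Qed.

(* The moment condition at the single point y reaches every tilt s, through
   t = s - T y. *)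
Let int_exp y s : YY y ->
  P.-integrable setT (EFin \o (fun w => p w * expR (s * X w))).
Proof.
move=> YYy; have [h0 [m m0 mE]] := marginal_pdf_gt0 YYy.
have := reg_mgf reg (s - T y) YYy; rewrite /cond_expectation mE inver gt_eqF//.
(* The Bayes numerator at [t = s - T y]: the density contributes a tilt [T y], which brings the
   total to [s]. *)
pose g w := expR ((s - T y) * X w) * f (X w) y.
have gE w : g w = h y * (p w * expR (s * X w)).
  rewrite /g fpE// mulrCA; congr (_ * _); rewrite mulrCA; congr (_ * _).
  by rewrite -expRD -mulrDl subrK.
have g0 w : 0 <= g w by rewrite gE !mulr_ge0 ?expR_ge0// ltW.
have mg : measurable_fun setT (fun w => p w * expR (s * X w)).
  apply: measurable_funM => //; apply: measurableT_comp => //.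
  exact: measurable_funM.
rewrite -[X in expectation _ X]/g unlock.
have I0 : (0 <= \int[P]_w (g w)%:E)%E.
  by apply: integral_ge0 => w _; rewrite lee_fin.
(* Dividing [+oo] by the positive real [m] leaves [+oo], so finiteness of the quotient passes to the
   numerator. *)
move=> I_lt; have gfin : (\int[P]_w (g w)%:E < +oo)%E.
  move: I0 I_lt; case: (integral _ _ _) => [r _ _| |]//; rewrite ?ltry//.
  by rewrite gt0_mulye// lte_fin invr_gt0.
have gint : P.-integrable setT (EFin \o g).
  apply/integrableP; split.
    apply/measurable_EFinP.
    have -> : g = (fun w => h y * (p w * expR (s * X w))).
      exact/funext.
    exact: measurable_funM.
  by under eq_integral do rewrite gee0_abs ?lee_fin//.
have := integrableZl measurableT (h y)^-1 gint.
apply: eq_integrable => // w _.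
by rewrite /= -EFinM gE mulKf// gt_eqF.
Qed.

Let M := tilted_moment P X p.

(** The point [y] enters only through [int_exp], which makes every tilt integrable. *)
Let dM (y : R) : YY y -> forall n s, is_derive s (1 : R) (M n) (M n.+1 s).
Proof.
move=> YYy n s; apply: is_derive_tilted_moment => [//|w|t].
- exact/ltW.
- exact: int_exp YYy.
Qed.

Let M_gt0 (y : R) : YY y -> forall s, 0 < M 0 s.
Proof.
move=> YYy s; apply: tilted_moment0_gt0 => [//|w|t||//].
- exact/ltW.
- exact: int_exp YYy.
- by rewrite [X in X != _](@probability_setT _ _ _ P) onee_neq0.
Qed.

Let cond_expectationE (g : R -> R) y : YY y ->
  P.-integrable setT (EFin \o (fun w => g (X w) * (p w * expR (T y * X w)))) ->
  cond_expectation X f g y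
    = (\int[P]_w (g (X w) * (p w * expR (T y * X w))) / M 0 (T y))%:E.
Proof.
move=> YYy gint; have [h0 _] := marginal_pdf_gt0 YYy.
have EE (k : R -> R) :
    P.-integrable setT
      (EFin \o (fun w => k (X w) * (p w * expR (T y * X w)))) ->
    'E_P[fun w => (k (X w) * f (X w) y)%R]%E
      = (h y * \int[P]_w (k (X w) * (p w * expR (T y * X w))))%:E.
  move=> kint; rewrite unlock /Rintegral EFinM fineK; last first.
    exact: integrable_fin_num.
  rewrite -integralZl//; apply: eq_integral => w _.
  by rewrite fpE// mulrCA.
(* The marginal is the numerator for the constant function 1, taken as [x ^+ 0] to match the moment
   of order 0. *)
have mE : marginal_pdf X f y = (h y * M 0 (T y))%:E.
  rewrite -(EE (fun x => x ^+ 0)); last first.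
    by apply: integrable_tilted => [//|w|t]; [exact/ltW|exact: int_exp YYy].
  by congr expectation; apply/funext => w; rewrite expr0 mul1r.
have M0 := M_gt0 YYy (T y).
rewrite /cond_expectation EE// mE inver gt_eqF ?mulr_gt0// -EFinM.
by congr EFin; rewrite invfM mulrACA mulfV ?mul1r// gt_eqF.
Qed.

Let cond_meanE y : YY y -> cond_mean X f y = log_derivative M (T y).
Proof.
move=> YYy; rewrite /cond_mean (cond_expectationE YYy)//=.
apply: (@integrable_tilted _ _ _ P X p _ _ _ 1) => [//|w|t].
- exact/ltW.
- exact: int_exp YYy.
Qed.

(** Multiplying by [exp(t X)] moves the tilt from [T y] to [t + T y], and the logarithm turns the
    Bayes quotient into a difference. *)
Let cond_cgfE y : YY y ->
  cond_cgf X f y = (fun t => ln (M 0 (t + T y)) - ln (M 0 (T y))).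
Proof.
move=> YYy; apply/funext => t.
have gE w : expR (t * X w) * (p w * expR (T y * X w))
    = X w ^+ 0 * (p w * expR ((t + T y) * X w)).
  by rewrite expr0 mul1r mulrCA -expRD -mulrDl.
rewrite /cond_cgf (cond_expectationE YYy)/=; last first.
  apply: (eq_integrable _ (EFin \o
    (fun w => X w ^+ 0 * (p w * expR ((t + T y) * X w))))) => //.
    by move=> w _; rewrite /= gE.
  by apply: integrable_tilted => [//|w|s]; [exact/ltW|exact: int_exp YYy].
under eq_Rintegral do rewrite gE.
by rewrite ln_div// posrE; exact: M_gt0 YYy _.
Qed.

Let dL (y : R) : YY y ->
  forall k s, derivable (derive1n k (log_derivative M)) s 1.
Proof.
move=> YYy k s; apply: derivable_log_derivativen.
- exact: dM YYy.
- exact: M_gt0 YYy.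
Qed.

Let is_derive_cond_cgf y t : YY y ->
  is_derive t (1 : R) (cond_cgf X f y) (log_derivative M (t + T y)).
Proof.
move=> YYy; rewrite cond_cgfE//.
have dln := is_derive_ln_moment (dM YYy) (M_gt0 YYy) (t + T y).
have dK := @is_derive1_comp _ (fun s => ln (M 0 s)) (shift (T y)) _ _ _ dln
  (is_derive_shift _ _ _).
rewrite mulr1 in dK.
have -> : (fun t => ln (M 0 (t + T y)) - ln (M 0 (T y)))
  = ((fun s => ln (M 0 s)) \o shift (T y)) - cst (ln (M 0 (T y))) by [].
by apply: is_derive_eq; rewrite subr0.
Qed.

(** One derivative removes the constant [ln (M 0 (T y))] and turns [ln (M 0)] into its logarithmic
    derivative; the remaining [k] commute with the shift by [T y]. *)
Lemma derive1n_cond_cgf y k : YY y ->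
  derive1n k.+1 (cond_cgf X f y)
    = (fun t => derive1n k (log_derivative M) (t + T y)).
Proof.
move=> YYy; rewrite derive1Sn -derive1n_shift; last exact: dL YYy.
congr derive1n; apply/funext => t.
by rewrite derive1E; have [_ ->] := is_derive_cond_cgf t YYy.
Qed.

Lemma diff_times_near_cond_cgf y l : YY y ->
  diff_times_near l (cond_cgf X f y) 0.
Proof.
(* Order 0 is treated apart, since the formula for the derivatives starts at order 1. *)
move=> YYy k _; near=> t; case: k => [|k].
  by have [] := is_derive_cond_cgf t YYy.
rewrite derive1n_cond_cgf//.
apply/derivable1_diffP.
apply: (@differentiable_comp _ _ _ _ (shift (T y)));
  apply/derivable1_diffP => //.
exact: dL YYy _ _.
Unshelve. all: by end_near. Qed.

Lemma cond_cumulantE y k : YY y ->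
  cond_cumulant X f k.+1 y = derive1n k (log_derivative M) (T y).
Proof. by move=> YYy; rewrite /cond_cumulant derive1n_cond_cgf// add0r. Qed.

Let near_cond_mean y : YY y ->
  \forall z \near y, cond_mean X f z = log_derivative M (T z).
Proof.
move=> YYy; have : \forall z \near y, YY z.
  by apply: open_nbhs_nbhs; split=> //; exact: ef_open fam.
by apply: filterS => z; exact: cond_meanE.
Qed.

(** Analyticity makes [T'] continuous, so its nonvanishing at [y] persists nearby. *)
Let near_dT y : YY y -> derive1 T y != 0 ->
  \forall z \near y, derivable T z 1 /\ derive1 T z != 0.
Proof.
move=> YYy T'y; have [dT cT'] := analytic_on_C1 (ef_T_analytic fam) YYy.
have {}cT' : derive1 T z @[z --> y] --> derive1 T y := cT'.
have nT' : \forall z \near y, derive1 T z != 0 by exact: (cvgr_neq0 _ cT').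
by near=> z; split; near: z.
Unshelve. all: by end_near. Qed.

(** Both sides equal the [k]-th derivative of [log_derivative M] at [T y]. *)
Lemma cond_cumulant_D_iter y k : YY y -> derive1 T y != 0 ->
  cond_cumulant X f k.+1 y = D_iter T k (cond_mean X f) y.
Proof.
move=> YYy T'y; rewrite cond_cumulantE//; apply/esym.
have := D_iter_comp k (dL YYy) (near_cond_mean YYy) (near_dT YYy T'y).
exact: nbhs_singleton.
Qed.

Lemma D_iter_defined_cond_mean y k : YY y -> derive1 T y != 0 ->
  D_iter_defined T k (cond_mean X f) y.
Proof.
move=> YYy T'y.
exact: D_iter_comp_defined (dL YYy) (near_cond_mean YYy) (near_dT YYy T'y).
Qed.

End conditional_moments.

Theorem proposition3 (R : realType) (d : measure_display)
    (Omega : measurableType d) (P : probability Omega R)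
    (X Y : {RV P >-> R}) (XX YY : set R) (T phi h : R -> R) (f : R -> R -> R)
    (hX : forall w, XX (X w)) (hY : forall w, YY (Y w))
    (hfam : exponential_family XX YY T phi h)
    (hpdf : is_conditional_pdf X Y XX YY f)
    (hform : forall x y, XX x -> YY y -> f x y = h y * expR (x * T y - phi x))
    (hreg : regularity X XX YY f)
    (l : nat) (hl : (1 <= l)%N) (y : R) (hy : YY y) (hTy : derive1 T y != 0) :
  [/\ diff_times_near l (cond_cgf X f y) 0,
      D_iter_defined T l.-1 (cond_mean X f) y &
      cond_cumulant X f l y = D_iter T l.-1 (cond_mean X f) y].
Proof.
case: l hl => // k _; split.
- exact: (diff_times_near_cond_cgf hX hfam hform hreg).
- exact: (D_iter_defined_cond_mean hX hfam hform hreg).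
- exact: (cond_cumulant_D_iter hX hfam hform hreg).
Qed.
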